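(* Let $\mathcal A^{\mathfrak{sl}_2}=\ker D_-\cap\ker D_+$ be the space of $\mathfrak{sl}_2$-invariants of the graph algebra $\mathcal A$, and let $\omega:\mathcal A\to\mathcal A$ be the linear involution $\omega(\boldsymbol{x}_S)=\boldsymbol{x}_{[m]\setminus S}$. Then: (i) $\omega\bigl(\mathcal A^{\mathfrak{sl}_2}\bigr)=\mathcal A^{\mathfrak{sl}_2}$. (ii) $\mathcal A^{\mathfrak{sl}_2}=P_{m/2}$ if $m$ is even, and $\mathcal A^{\mathfrak{sl}_2}=0$ if $m$ is odd.
   Context: Let $m=\binom n2$, where $n$ is the number of vertices, and $[m]=\{1,\dots,m\}$. The graph algebra is $\mathcal A=\mathbb C[x_1,\dots,x_m]/(x_1^2-x_1,\dots,x_m^2-x_m)$, with vector space basis $\boldsymbol{x}_S=\prod_{e\in S}x_e$, $S\subseteq[m]$. For $0\le k\le m$, $A_k=\operatorname{span}_{\mathbb C}\{\boldsymbol{x}_S:|S|=k\}$, and $A_{-1}=0$. Linear operators on $\mathcal A$ are defined by $D_+(\boldsymbol{x}_S)=\sum_{e\in[m]\setminus S}\boldsymbol{x}_{S\cup\{e\}}$ and $D_-(\boldsymbol{x}_S)=\sum_{e\in S}\boldsymbol{x}_{S\setminus\{e\}}$ (empty sums are zero). The primitive spaces are $P_k=\ker(D_-:A_k\to A_{k-1})$. *)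

(* Defs.v *)
From HB Require Import structures.
From mathcomp Require Import all_boot all_order all_algebra.
From mathcomp Require Import generic_quotient ring_quotient ssrcomplements mpoly.
From mathcomp Require boolp.

Set Implicit Arguments.
Unset Strict Implicit.
Unset Printing Implicit Defensive.

Import GRing.Theory.
Local Open Scope ring_scope.
Local Open Scope quotient_scope.

Section GraphAlgebra.

Variables (F : fieldType) (m : nat).
Implicit Types (S T : {set 'I_m}) (p q : {mpoly F[m]}) (u v : 'X_{1..m}).

(* The ideal (x_1^2 - x_1, ..., x_m^2 - x_m); [boolp.asbool] only turns the
   membership proposition into the boolean predicate [ring_quotient] wants. *)
Definition idem_ideal : {pred {mpoly F[m]}} := fun p =>
  boolp.asbool (exists q : 'I_m -> {mpoly F[m]},
                  p = \sum_i q i * ('X_i ^+ 2 - 'X_i)).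

Lemma idem_idealP p :
  reflect (exists q : 'I_m -> {mpoly F[m]},
             p = \sum_i q i * ('X_i ^+ 2 - 'X_i)) (p \in idem_ideal).
Proof. exact: boolp.asboolP. Qed.

Lemma idem_ideal_closed : idealr_closed idem_ideal.
Proof.
split.
- by apply/idem_idealP; exists (fun=> 0); rewrite big1 // => i _; rewrite mul0r.
- apply/idem_idealP => -[q /(congr1 (fun p => p.@[fun=> 0]))].
  rewrite meval1 raddf_sum big1 => [/eqP|i _]; first by rewrite oner_eq0.
  by rewrite /= mevalM mevalB expr2 mevalM mevalXU mulr0 subr0 mulr0.
- move=> a p r /idem_idealP[q ->] /idem_idealP[q' ->].
  apply/idem_idealP; exists (fun i => a * q i + q' i).
  by rewrite mulr_sumr -big_split; apply: eq_bigr => i _; rewrite mulrDl mulrA.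
Qed.

HB.instance Definition _ :=
  isIdealr.Build {mpoly F[m]} idem_ideal idem_ideal_closed.

Definition graph_alg := {ideal_quot idem_ideal}.

HB.instance Definition _ := GRing.ComNzRing.on graph_alg.

Definition to_alg p : graph_alg := \pi_({ideal_quot idem_ideal}) p.

Lemma to_algB : zmod_morphism to_alg.
Proof. by move=> p q; rewrite /to_alg raddfB. Qed.

Lemma to_algM : monoid_morphism to_alg.
Proof. by split=> [|p q]; rewrite /to_alg ?rmorph1 ?rmorphM. Qed.

HB.instance Definition _ :=
  GRing.isZmodMorphism.Build {mpoly F[m]} graph_alg to_alg to_algB.
HB.instance Definition _ :=
  GRing.isMonoidMorphism.Build {mpoly F[m]} graph_alg to_alg to_algM.

Definition of_alg (a : graph_alg) : {mpoly F[m]} :=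
  repr (a : {ideal_quot idem_ideal}).

Lemma of_algK : cancel of_alg to_alg.
Proof. by move=> a; apply: reprK. Qed.

Lemma to_alg_eq p q : (to_alg p == to_alg q) = (p - q \in idem_ideal).
Proof. by rewrite Quotient.idealrBE. Qed.

Definition scale_alg (c : F) (a : graph_alg) : graph_alg := to_alg c%:MP * a.

Fact scale_algA c d a : scale_alg c (scale_alg d a) = scale_alg (c * d) a.
Proof. by rewrite /scale_alg mulrA -rmorphM -mpolyCM. Qed.
Fact scale_alg1 : left_id 1 scale_alg.
Proof. by move=> a; rewrite /scale_alg mpolyC1 rmorph1 mul1r. Qed.
Fact scale_algDr : right_distributive scale_alg +%R.
Proof. by move=> c a b; rewrite /scale_alg mulrDr. Qed.
Fact scale_algDl a : {morph scale_alg^~ a : c d / c + d}.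
Proof. by move=> c d; rewrite /scale_alg mpolyCD rmorphD mulrDl. Qed.

HB.instance Definition _ := GRing.Zmodule_isLmodule.Build F graph_alg
  scale_algA scale_alg1 scale_algDr scale_algDl.

Fact scale_algAl (c : F) (a b : graph_alg) : c *: (a * b) = c *: a * b.
Proof. exact: mulrA. Qed.

HB.instance Definition _ :=
  GRing.Lmodule_isLalgebra.Build F graph_alg scale_algAl.
HB.instance Definition _ := GRing.Lalgebra_isComAlgebra.Build F graph_alg.

Lemma to_algZ : scalable to_alg.
Proof. by move=> c p; rewrite -mul_mpolyC rmorphM. Qed.

HB.instance Definition _ :=
  GRing.isScalable.Build F {mpoly F[m]} graph_alg _ to_alg to_algZ.

Definition xS S : graph_alg := \prod_(e in S) to_alg 'X_e.

(* The coefficient of x_S in the reduction of p modulo x_e^2 = x_e: each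
   monomial reduces to the squarefree monomial with the same support. *)
Definition mnmsupp u : {set 'I_m} := [set e | u e != 0%N].

Definition pcoord S p : F := \sum_(u <- msupp p | mnmsupp u == S) p@_u.

Definition acoord S (a : graph_alg) : F := pcoord S (of_alg a).

Lemma pcoordwE S (k : nat) p : (msize p <= k)%N ->
  pcoord S p = \sum_(u : 'X_{1..m < k} | mnmsupp u == S) p@_u.
Proof.
move=> lt_pk; pose I : subFinType _ := 'X_{1..m < k}.
rewrite /pcoord (big_mksub_cond I) //=; first last.
- by move=> u /msize_mdeg_lt lt_uk _; apply: leq_trans lt_uk lt_pk.
- exact: msupp_uniq.
rewrite [RHS](bigID (fun u : I => bmnm u \in msupp p)) /=.
rewrite [X in _ = _ + X]big1 ?addr0 => [|u /andP[_ /memN_msupp_eq0 //]].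
by apply: eq_bigl => u; rewrite andbC.
Qed.

Fact pcoord_is_linear S : linear_for *%R (pcoord S).
Proof.
move=> c p q; pose k := maxn (msize (c *: p + q)) (maxn (msize p) (msize q)).
have [k1 k2 k3] : [/\ msize (c *: p + q) <= k, msize p <= k & msize q <= k]%N.
  by rewrite !leq_max !leqnn !orbT.
rewrite !(@pcoordwE S k) // mulr_sumr -big_split; apply: eq_bigr => u _ /=.
by rewrite mcoeffD mcoeffZ.
Qed.

HB.instance Definition _ S := GRing.isLinear.Build F {mpoly F[m]} F *%R
  (pcoord S) (pcoord_is_linear S).

Lemma pcoordX S u : pcoord S 'X_[u] = (mnmsupp u == S)%:R.
Proof.
by rewrite /pcoord msuppX big_cons big_nil mcoeffX eqxx; case: ifP; rewrite ?addr0.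
Qed.

Lemma pcoord_ideal S p : p \in idem_ideal -> pcoord S p = 0.
Proof.
case/idem_idealP=> q ->; rewrite raddf_sum big1 // => i _.
rewrite [q i]mpolyE mulr_suml raddf_sum big1 // => u _ /=.
rewrite -scalerAl linearZ /= mulrBr raddfB /= mpolyXn -!mpolyXD !pcoordX.
suff -> : mnmsupp (u + U_(i) *+ 2)%MM = mnmsupp (u + U_(i))%MM.
  by rewrite subrr mulr0.
apply/setP=> e; rewrite !inE !mnmDE !addn_eq0 !mnm1E.
by case: (i == e).
Qed.

Lemma acoord_to_alg S p : acoord S (to_alg p) = pcoord S p.
Proof.
apply/eqP; rewrite -subr_eq0 -raddfB; apply/eqP/pcoord_ideal.
by rewrite -to_alg_eq of_algK.
Qed.

Fact acoord_is_linear S : linear_for *%R (acoord S).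
Proof.
move=> c a b; rewrite -[a]of_algK -[b]of_algK -linearP !acoord_to_alg.
exact: linearP.
Qed.

HB.instance Definition _ S := GRing.isLinear.Build F graph_alg F *%R
  (acoord S) (acoord_is_linear S).

Lemma to_algX u : to_alg 'X_[u] = xS (mnmsupp u).
Proof.
rewrite mpolyXE_id rmorph_prod /xS [RHS]big_mkcond; apply: eq_bigr => e _ /=.
rewrite inE; case: (u e) => [|k]; first by rewrite expr0 rmorph1.
elim: k => // k IHk; rewrite exprS rmorphM /= IHk -rmorphM -expr2.
apply/eqP; rewrite to_alg_eq; apply/idem_idealP.
exists (fun i => (i == e)%:R); rewrite (bigD1 e) //= eqxx mul1r.
by rewrite big1 ?addr0 // => i /negbTE->; rewrite mul0r.
Qed.

Lemma xS_mono S : xS S = to_alg 'X_[(\sum_(e in S) U_(e))%MM].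
Proof.
by rewrite (big_morph _ (@mpolyXD m F) (@mpolyX0 m F)) rmorph_prod.
Qed.

Lemma acoord_xS S T : acoord S (xS T) = (S == T)%:R.
Proof.
rewrite xS_mono acoord_to_alg pcoordX eq_sym; congr (_ == _)%:R.
apply/setP=> e; rewrite inE mnm_sumE sum_nat_eq0 negb_forall.
apply/existsP/idP=> [[i]|eT]; last by exists e; rewrite eT mnm1E eqxx.
by rewrite mnm1E negb_imply eqb0 negbK => /andP[iT /eqP <-].
Qed.

Lemma acoordE a : a = \sum_S acoord S a *: xS S.
Proof.
rewrite -[a]of_algK; set p := of_alg a; rewrite [in LHS](mpolyE p) raddf_sum /=.
rewrite (partition_big mnmsupp predT) //=; apply: eq_bigr => S _.
rewrite acoord_to_alg scaler_suml; apply: eq_bigr => u /eqP <-.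
by rewrite linearZ /= to_algX.
Qed.

Fact graph_alg_vect_iso : Vector.axiom #|{set 'I_m}| graph_alg.
Proof.
exists (fun a => \row_i acoord (enum_val i) a) => [c a b|].
  by apply/rowP=> i; rewrite !mxE linearP.
exists (fun v : 'rV_#|{set 'I_m}| => \sum_S v 0 (enum_rank S) *: xS S).
  move=> a; rewrite [RHS]acoordE; apply: eq_bigr => S _.
  by rewrite mxE enum_rankK.
move=> v; apply/rowP=> i; rewrite mxE linear_sum (bigD1 (enum_val i)) //=.
rewrite linearZ /= acoord_xS eqxx mulr1 enum_valK big1 ?addr0 // => S neqSi.
by rewrite linearZ /= acoord_xS eq_sym (negbTE neqSi) mulr0.
Qed.

HB.instance Definition _ :=
  Lmodule_hasFinDim.Build F graph_alg graph_alg_vect_iso.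

(* The linear operator with prescribed values on the basis (x_S)_S. *)
Definition lin_ext (f : {set 'I_m} -> graph_alg) : 'End(graph_alg) :=
  linfun (fun a => \sum_S acoord S a *: f S).

Lemma lin_extE f a : lin_ext f a = \sum_S acoord S a *: f S.
Proof.
pose g a := \sum_S acoord S a *: f S.
have g_lin : linear g.
  move=> c b d; rewrite /g scaler_sumr -big_split; apply: eq_bigr => S _.
  by rewrite linearP scalerDl scalerA.
pose gL := GRing.isLinear.Build F graph_alg graph_alg *:%R g g_lin.
pose g' : {linear graph_alg -> graph_alg} := HB.pack g gL.
exact: (lfunE g').
Qed.

Lemma lin_ext_xS f S : lin_ext f (xS S) = f S.
Proof.
rewrite lin_extE (bigD1 S) //= acoord_xS eqxx scale1r big1 ?addr0 // => T neqTS.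
by rewrite acoord_xS (negbTE neqTS) scale0r.
Qed.

Definition Dplus := lin_ext (fun S => \sum_(e in ~: S) xS (e |: S)).
Definition Dminus := lin_ext (fun S => \sum_(e in S) xS (S :\ e)).
Definition omega := lin_ext (fun S => xS (~: S)).

Lemma Dplus_xS S : Dplus (xS S) = \sum_(e in ~: S) xS (e |: S).
Proof. exact: lin_ext_xS. Qed.
Lemma Dminus_xS S : Dminus (xS S) = \sum_(e in S) xS (S :\ e).
Proof. exact: lin_ext_xS. Qed.
Lemma omega_xS S : omega (xS S) = xS (~: S).
Proof. exact: lin_ext_xS. Qed.

Lemma omegaK : involutive omega.
Proof.
move=> a; rewrite [a]acoordE !linear_sum; apply: eq_bigr => S _ /=.
by rewrite !linearZ /= !omega_xS setCK.
Qed.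

Definition graded (k : nat) : {vspace graph_alg} :=
  (\sum_(S : {set 'I_m} | #|S| == k) <[xS S]>)%VS.

(* ker (D_- : A_k -> A_{k-1}), as a subspace of the whole algebra. *)
Definition primitive (k : nat) : {vspace graph_alg} :=
  (graded k :&: lker Dminus)%VS.

Definition sl2_inv : {vspace graph_alg} := (lker Dminus :&: lker Dplus)%VS.

End GraphAlgebra.

Arguments Dplus {F m}.
Arguments Dminus {F m}.
Arguments omega {F m}.
Arguments graded : clear implicits.
Arguments primitive : clear implicits.
Arguments sl2_inv : clear implicits.

(* Main.v *)
Require Import Defs.
From mathcomp Require Import all_boot all_order all_algebra complex reals.

(** The algebra carries an action of sl_2 in which D_+ and D_- are the raising
    and lowering operators: their commutator [D_-, D_+] multiplies x_S by
    m - 2|S| ([acoord_commutator]).  An element killed by both operators is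
    killed by the commutator, so in characteristic 0 only sets with 2|S| = m
    occur in it: there are none when m is odd, and it is primitive of degree m/2
    when m is even.

    Conversely let a be primitive of degree m/2.  The commutator vanishes on a,
    so D_- D_+ a = D_+ D_- a = 0.  As D_+ and D_- are adjoint for the Hermitian
    form that makes the x_S orthonormal ([acoord_Dplus_adjoint]), the squared
    norm of D_+ a is the product of a with D_- D_+ a, that is 0; positivity
    gives D_+ a = 0.

    Finally, complementation of sets exchanges adding and removing an element,
    so omega intertwines D_- with D_+ and preserves the intersection of their
    kernels.

    All computations are made on coordinates, where D_- a and D_+ a become sums
    over the sets covering, respectively covered by, a given set. *)

Set Implicit Arguments.
Unset Strict Implicit.
Unset Printing Implicit Defensive.

Import GRing.Theory Num.Theory.
Local Open Scope ring_scope.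
Local Open Scope complex_scope.

Section Coordinates.

Variables (F : fieldType) (m : nat).
Implicit Types (S T : {set 'I_m}) (a b : graph_alg F m).

Lemma acoord_inj a b : (forall S, acoord S a = acoord S b) -> a = b.
Proof.
by move=> eq_ab; rewrite [a]acoordE [b]acoordE; apply: eq_bigr => S _; rewrite eq_ab.
Qed.

Lemma acoord_omega T a : acoord T (omega a) = acoord (~: T) a.
Proof.
rewrite lin_extE linear_sum (bigD1 (~: T)) //= linearZ /= acoord_xS setCK eqxx.
rewrite mulr1 big1 ?addr0 // => S neqST; rewrite linearZ /= acoord_xS.
rewrite (_ : T == ~: S = false) ?mulr0 //.
by apply: contraNF neqST => /eqP->; rewrite setCK.
Qed.

Lemma acoord_Dplus T a :
  acoord T (Dplus a) = \sum_(e in T) acoord (T :\ e) a.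
Proof.
rewrite lin_extE linear_sum /=.
under eq_bigr => S _ do rewrite linearZ linear_sum /= mulr_sumr.
rewrite (exchange_big_dep predT) //= [RHS]big_mkcond; apply: eq_bigr => e _.
case: ifPn => eT; last first.
  rewrite big1 // => S _; rewrite acoord_xS (_ : T == e |: S = false) ?mulr0 //.
  by apply: contraNF eT => /eqP->; rewrite setU11.
rewrite (bigD1 (T :\ e)) ?inE ?eqxx //= acoord_xS setD1K // eqxx mulr1.
rewrite big1 ?addr0 // => S; rewrite inE => /andP[eS neqS].
rewrite acoord_xS (_ : T == e |: S = false) ?mulr0 //.
by apply: contraNF neqS => /eqP->; rewrite setU1K.
Qed.

Lemma acoord_Dminus T a :
  acoord T (Dminus a) = \sum_(e in ~: T) acoord (e |: T) a.
Proof.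
rewrite lin_extE linear_sum /=.
under eq_bigr => S _ do rewrite linearZ linear_sum /= mulr_sumr.
rewrite (exchange_big_dep predT) //= [RHS]big_mkcond; apply: eq_bigr => e _.
rewrite inE; case: ifPn => [eT|/negPn eT]; last first.
  rewrite big1 // => S _; rewrite acoord_xS (_ : T == S :\ e = false) ?mulr0 //.
  by apply: contraTF eT => /eqP->; rewrite !inE eqxx.
rewrite (bigD1 (e |: T)) ?setU11 //= acoord_xS setU1K // eqxx mulr1.
rewrite big1 ?addr0 // => S /andP[eS neqS].
rewrite acoord_xS (_ : T == S :\ e = false) ?mulr0 //.
by apply: contraNF neqS => /eqP->; rewrite setD1K.
Qed.

Lemma memv_gradedP k a :
  reflect (forall S, #|S| != k -> acoord S a = 0) (a \in graded F m k).
Proof.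
apply: (iffP idP) => [/memv_sumP[b b_in ->] S neqSk | a0].
  rewrite linear_sum big1 //= => T /eqP eqTk.
  have /vlineP[c ->] := b_in T (introT eqP eqTk).
  rewrite linearZ /= acoord_xS (_ : S == T = false) ?mulr0 //.
  by apply: contraNF neqSk => /eqP->; rewrite eqTk.
rewrite [a]acoordE (bigID (fun S : {set 'I_m} => #|S| == k)) /=.
rewrite [X in _ + X]big1 ?addr0 => [|S /a0->]; last by rewrite scale0r.
by apply: memv_sumr => S _; apply: memvZ; apply: memv_line.
Qed.

(** Exchanging an element f of T with an element e outside T can be done in
    either order, so these terms cancel in the commutator; what remains is one
    copy of the coordinate at T for each e outside T (added, then removed) and
    minus one for each f in T (removed, then added). *)
Lemma acoord_commutator T a :
  acoord T (Dminus (Dplus a)) - acoord T (Dplus (Dminus a))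
    = (m%:R - #|T|%:R *+ 2) * acoord T a.
Proof.
have up e : e \in ~: T -> acoord (e |: T) (Dplus a)
    = acoord T a + \sum_(f in T) acoord (e |: (T :\ f)) a.
  rewrite inE => eT; rewrite acoord_Dplus big_setU1 //= setU1K //.
  congr (_ + _); apply: eq_bigr => f fT; congr (acoord _ a).
  rewrite setDUl; congr (_ :|: _); apply/setP=> x; rewrite !inE andbC.
  by case: eqP => // ->; apply: contraNneq eT => ->.
have down f : f \in T -> acoord (T :\ f) (Dminus a)
    = acoord T a + \sum_(e in ~: T) acoord (e |: (T :\ f)) a.
  move=> fT; rewrite acoord_Dminus.
  have -> : ~: (T :\ f) = f |: ~: T.
    by apply/setP=> x; rewrite !inE negb_and negbK.
  by rewrite big_setU1 ?inE ?fT //= setD1K.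
rewrite acoord_Dminus acoord_Dplus (eq_bigr _ up) (eq_bigr _ down).
rewrite !big_split /= [X in _ + X - _]exchange_big /= opprD addrACA subrr addr0.
rewrite !sumr_const -[_ *+ #|~: T|]mulr_natl -[_ *+ #|T|]mulr_natl -mulrBl.
congr (_ * _); rewrite -[in m%:R](card_ord m) -(cardsC T) natrD.
by rewrite mulr2n opprD addrA [X in _ = X - _]addrAC subrr add0r.
Qed.

(** Adjointness of D_+ and D_- for the pairing that makes the x_S orthonormal;
    the second argument is an arbitrary function on sets so that it can be
    specialized to conjugated coordinates. *)
Lemma acoord_Dplus_adjoint a (g : {set 'I_m} -> F) :
  \sum_S acoord S (Dplus a) * g S
    = \sum_S acoord S a * \sum_(e in ~: S) g (e |: S).
Proof.
under eq_bigr => S _ do rewrite acoord_Dplus mulr_suml.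
under [RHS]eq_bigr => S _ do rewrite mulr_sumr.
rewrite (exchange_big_dep predT) // [RHS](exchange_big_dep predT) //=.
apply: eq_bigr => e _.
rewrite (reindex_onto (fun S => e |: S) (fun S => S :\ e)); last first.
  by move=> S eS; rewrite setD1K.
apply: eq_big => [S|S /andP[_ /eqP->]] //.
rewrite setU11 inE; apply/eqP/idP => [<-|eS]; last by rewrite setU1K.
by rewrite !inE eqxx.
Qed.

Lemma Dminus_omega a : Dminus (omega a) = omega (Dplus a).
Proof.
apply: acoord_inj => T; rewrite acoord_omega acoord_Dminus acoord_Dplus.
by apply: eq_bigr => e _; rewrite acoord_omega setCU setDE setIC.
Qed.

Lemma Dplus_omega a : Dplus (omega a) = omega (Dminus a).
Proof. by rewrite -[in RHS](omegaK a) Dminus_omega omegaK. Qed.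

Lemma mem_sl2_inv a :
  (a \in sl2_inv F m) = (Dminus a == 0) && (Dplus a == 0).
Proof. by rewrite memv_cap !memv_ker. Qed.

Lemma omega_sl2_inv : (omega @: sl2_inv F m)%VS = sl2_inv F m.
Proof.
have stable a : a \in sl2_inv F m -> omega a \in sl2_inv F m.
  rewrite !mem_sl2_inv Dminus_omega Dplus_omega => /andP[/eqP-> /eqP->].
  by rewrite linear0 eqxx.
apply/vspaceP=> a; apply/memv_imgP/idP => [[b b_inv ->]|a_inv].
  exact: stable.
by exists (omega a); [exact: stable | rewrite omegaK].
Qed.

End Coordinates.

Section CharacteristicZero.

Variables (F : numFieldType) (m : nat).

(** The invariants have weight 0: the commutator multiplies this coordinate by
    the nonzero scalar m - 2|T|. *)
Lemma acoord_sl2_inv (a : graph_alg F m) (T : {set 'I_m}) :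
  a \in sl2_inv F m -> #|T|.*2 != m -> acoord T a = 0.
Proof.
rewrite mem_sl2_inv => /andP[/eqP Dm0 /eqP Dp0] neqTm.
have := acoord_commutator T a; rewrite Dm0 Dp0 !linear0 subrr.
move/esym/eqP; rewrite mulf_eq0 => /orP[|/eqP //].
by rewrite -mulrnA muln2 subr_eq0 eqr_nat eq_sym (negbTE neqTm).
Qed.

Lemma sl2_inv_odd : odd m -> sl2_inv F m = 0%VS.
Proof.
move=> odd_m; apply/eqP; rewrite -subv0; apply/subvP=> a a_inv.
rewrite memv0; apply/eqP/acoord_inj => T; rewrite linear0.
apply: acoord_sl2_inv => //; apply: contraTneq odd_m => <-.
by rewrite odd_double.
Qed.

Lemma sl2_inv_sub_primitive : (sl2_inv F m <= primitive F m m./2)%VS.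
Proof.
apply/subvP=> a a_inv; rewrite memv_cap; apply/andP; split.
  apply/memv_gradedP => T neqT; apply: acoord_sl2_inv => //.
  by apply: contraNneq neqT => /(congr1 half) <-; rewrite doubleK.
by move: a_inv; rewrite mem_sl2_inv memv_ker => /andP[-> _].
Qed.

End CharacteristicZero.

Section Hermitian.

Variables (F : numClosedFieldType) (m : nat).

(** The squared norm of D_+ a is the Hermitian product of a and D_- D_+ a. *)
Lemma Dplus_eq0 (a : graph_alg F m) : Dminus (Dplus a) = 0 -> Dplus a = 0.
Proof.
move=> DD0.
have norm0 : \sum_S `|acoord S (Dplus a)| ^+ 2 = 0.
  under eq_bigr => S _ do rewrite normCK.
  rewrite acoord_Dplus_adjoint big1 // => S _.
  by rewrite -rmorph_sum -acoord_Dminus DD0 linear0 rmorph0 mulr0.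
apply: acoord_inj => T; rewrite linear0; apply/eqP.
rewrite -normr_eq0 -sqrf_eq0; apply/eqP.
by apply: (psumr_eq0P _ norm0) => // S _; apply: exprn_ge0.
Qed.

Lemma sl2_inv_even : ~~ odd m -> sl2_inv F m = primitive F m m./2.
Proof.
move=> even_m; apply/eqP; rewrite eqEsubv sl2_inv_sub_primitive /=.
apply/subvP=> a; rewrite memv_cap memv_ker mem_sl2_inv.
case/andP=> /memv_gradedP a_half Dm0; rewrite Dm0 /=.
apply/eqP/Dplus_eq0/acoord_inj => T; rewrite linear0.
have := acoord_commutator T a; rewrite (eqP Dm0) !linear0 subr0 => ->.
have [eqT|/a_half->] := eqVneq #|T| m./2; last by rewrite mulr0.
by rewrite eqT -mulrnA muln2 even_halfK // subrr mul0r.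
Qed.

End Hermitian.

Theorem theorem3p6 (R : realType) (n : nat) :
  let m := 'C(n, 2) in
  [/\ (omega @: sl2_inv R[i] m)%VS = sl2_inv R[i] m,
      ~~ odd m -> sl2_inv R[i] m = primitive R[i] m m./2
    & odd m -> sl2_inv R[i] m = 0%VS].
Proof.
move=> m; split; first exact: omega_sl2_inv.
  exact: sl2_inv_even.
exact: sl2_inv_odd.
Qed.
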